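(* Let $(Y_i(0), Y_i(1), A_i, W_i, X_i)$, $i=1,\dots,N$, be independent draws from a distribution $\mathcal{P}$, where $A_i\in\mathbb{Z}$ is the age of unit $i$, $W_i\in\{0,1\}$ is a binary treatment, $X_i$ is a vector of covariates, and $Y_i(0),Y_i(1)$ are the potential outcomes of unit $i$ under control and treatment; let $Y_i^{obs}$ be the observed outcome. Assume SUTVA (no interference and consistency), so that $Y_i^{obs}=Y_i(W_i)$, and assume unconfoundedness: $(Y_i(0),Y_i(1))$ is conditionally independent of $W_i$ given $X_i$. Then the age-conditioned treatment effect $\tau(a):=\mathbb{E}[Y_i(1)-Y_i(0)\mid A_i=a]$ satisfies $$\tau(a)=\mathbb{E}_{\mathcal{X}}\big[\mathbb{E}[Y_i^{obs}\mid W_i=1,A_i=a,X_i=x]\big]-\mathbb{E}_{\mathcal{X}}\big[\mathbb{E}[Y_i^{obs}\mid W_i=0,A_i=a,X_i=x]\big],$$ where $\mathbb{E}_{\mathcal{X}}$ denotes expectation over the covariate value $x$.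
   Context: SUTVA (Stable Unit Treatment Value Assumption) consists of two parts. (No interference) The potential outcomes of any unit do not vary with the treatments assigned to other units: for all treatment vectors $\mathbf{w},\mathbf{w}'\in\mathbb{R}^N$ of the $N$ units with $w_i=w_i'$, one has $Y_i(\mathbf{w})=Y_i(\mathbf{w}')$, so the potential outcome of unit $i$ can be written $Y_i(w_i)$. (Consistency) There is only one version of each treatment, and thus $Y_i^{obs}=Y_i(\mathbf{w})$ for the assigned treatments $\mathbf{w}$; combined with no interference, $Y_i^{obs}=Y_i(w_i)$. Unconfoundedness expresses that there are no unmeasured factors affecting both the probability of treatment allocation and the outcome. For $w\in\{0,1\}$ write $\mu_w(a,x):=\mathbb{E}[Y_i(w)\mid A_i=a,X_i=x]$. The symbol $\mathbb{E}_{\mathcal{X}}$ is averaging over covariates, used so that $\tau(a)=\mathbb{E}_{\mathcal{X}}[\mu_1(a,x)-\mu_0(a,x)]$; the source does not further specify the law of $x$ in this expectation.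
   Formalization: Unconfoundedness is assumed given (A_i, X_i), since given X_i alone the claim is false; overlap at age a, integrability of Y_i(0), Y_i(1) and P(A_i=a)>0 are added, and E_X averages over the law of X_i given A_i=a. *)

(* Defs.v *)
From HB Require Import structures.
From mathcomp Require Import all_boot all_order all_algebra.
From mathcomp Require Import all_classical all_reals all_analysis.
From mathcomp Require Import measurable_realfun.

Set Implicit Arguments.
Unset Strict Implicit.
Unset Printing Implicit Defensive.

Import Order.TTheory GRing.Theory Num.Theory.
Import numFieldNormedType.Exports.

Local Open Scope classical_set_scope.
Local Open Scope ring_scope.

HB.instance Definition _ := isPointed.Build int 0.

HB.instance Definition _ := @isMeasurable.Build default_measure_display
  int discrete_measurable discrete_measurable0
  discrete_measurableC discrete_measurableU.

Section conditioning.
Context d d' (T : measurableType d) (T' : measurableType d') (R : realType).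
Implicit Types (P : probability T R) (V : T -> T') (Z : T -> R).

(* [m] is a version of [v |-> E[Z | V = v]], i.e. [m \o V] is a version of
   E[Z | sigma(V)]. *)
Definition is_condE P V Z (m : T' -> R) : Prop :=
  [/\ measurable_fun [set: T'] m,
      P.-integrable [set: T] (EFin \o (m \o V)) &
      forall B, measurable B ->
        (\int[P]_(t in V @^-1` B) (m (V t))%:E =
         \int[P]_(t in V @^-1` B) (Z t)%:E)%E].

(* E[Z | V = v] as a function of [v]: a chosen version, unique up to a null set
   of the law of [V]; it exists as soon as [Z] is integrable (see [condEP]). *)
Definition condE P V Z : T' -> R := xget (cst 0) [set m | is_condE P V Z m].

Lemma condEP P V Z : measurable_fun [set: T] V ->
  P.-integrable [set: T] (EFin \o Z) -> is_condE P V Z (condE P V Z).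
Proof.
move=> mV iZ; suff [m mP] : exists m, is_condE P V Z m.
  exact: (@xgetPex _ (cst 0) [set m | is_condE P V Z m] (ex_intro _ m mP)).
have mVi A : measurable A -> measurable (V @^-1` A).
  by move=> mA; rewrite -[X in measurable X]setTI; exact: mV.
have [nu nuE] : exists nu : {charge set T' -> \bar R},
    forall A, nu A = pushforward (induced_charge iZ) V A.
  unshelve refine (ex_intro _ (pushforward (induced_charge iZ) V : {charge set T' -> \bar R}) _) => //.
pose mu := distribution P (mfun_Sub (mem_set mV)).
have numu : nu `<< mu.
  apply/null_content_dominatesP => A mA muA; rewrite nuE.
  have /integrableP[mZ _] :=
    integrableS measurableT (mVi _ mA) (@subsetT _ _) iZ.
  by apply: null_set_integral => //; exact: mVi.
pose h := Radon_Nikodym nu mu.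
have hfin v : h v \is a fin_num by exact: Radon_Nikodym_fin_num.
have hint : mu.-integrable [set: T'] h by exact: Radon_Nikodym_integrable.
have [mh hoo] := integrableP _ _ _ hint.
have hV : P.-integrable [set: T] (h \o V).
  apply/integrableP; split; first exact: measurableT_comp.
  move: hoo; rewrite ge0_integral_pushforward ?preimage_setT//.
  exact: measurableT_comp.
have hE : EFin \o (fine \o h) = h by apply/funext => v /=; rewrite fineK.
exists (fine \o h); split.
- exact: measurableT_comp.
- by rewrite [X in integrable _ _ X](_ : _ = h \o V)// -{2}hE.
- move=> B mB; under eq_integral do
    rewrite -[(_%:E)%E]/((EFin \o (fine \o h)) (V _)) hE.
  rewrite -[LHS]/(\int[P]_(t in V @^-1` B) (h \o V) t)%E.
  rewrite -integral_pushforward//; last first.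
    by apply: integrableS hV => //; exact: mVi.
  by rewrite -[LHS](Radon_Nikodym_integral numu mB) nuE.
Qed.

End conditioning.

Lemma measurable_eq_int d (T : measurableType d) (A : {mfun T >-> int})
  (a : int) : measurable (A @^-1` [set a]).
Proof. exact: measurable_funPTI. Qed.

(* P(. | A = a); [mnormalize] falls back to [P] itself when P(A = a) = 0. *)
Definition cond_prob d (T : measurableType d) (R : realType)
    (P : probability T R) (A : {mfun T >-> int}) (a : int) : probability T R :=
  mnormalize (mrestr P (measurable_eq_int A a)) P.

Definition cond_indep d d1 d2 d3 (T : measurableType d)
    (T1 : measurableType d1) (T2 : measurableType d2) (T3 : measurableType d3)
    (R : realType) (P : probability T R)
    (U1 : T -> T1) (U2 : T -> T2) (V : T -> T3) : Prop :=
  forall B1 B2, measurable B1 -> measurable B2 ->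
    {ae P, forall t,
      condE P V \1_(U1 @^-1` B1 `&` U2 @^-1` B2) (V t) =
      condE P V \1_(U1 @^-1` B1) (V t) * condE P V \1_(U2 @^-1` B2) (V t)}.

Definition mutually_independent d d' (T : measurableType d)
    (T' : measurableType d') (R : realType) (P : probability T R) (N : nat)
    (Z : 'I_N -> T -> T') : Prop :=
  forall (J : {set 'I_N}) (B : 'I_N -> set T'),
    (forall i, measurable (B i)) ->
    P (\bigcap_(i in [set` J]) (Z i @^-1` B i)) =
    (\prod_(i in J) P (Z i @^-1` B i))%E.

Definition iid_draws d d' (T : measurableType d) (T' : measurableType d')
    (R : realType) (P : probability T R) (Q : probability T' R) (N : nat)
    (Z : 'I_N -> T -> T') : Prop :=
  mutually_independent P Z /\
  forall i B, measurable B -> P (Z i @^-1` B) = Q B.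

Section outcomes.
Context d (T : measurableType d) (R : realType) (P : probability T R) (N : nat).
Implicit Types (Y : 'I_N -> 'rV[R]_N -> {RV P >-> R}).

Definition no_interference Y : Prop :=
  forall i (w w' : 'rV[R]_N), w 0 i = w' 0 i -> Y i w =1 Y i w'.

Definition consistency Y (W : 'I_N -> {RV P >-> bool})
    (Yobs : 'I_N -> {RV P >-> R}) : Prop :=
  forall i t, Yobs i t = Y i (\row_j (W j t)%:R) t.

(* Y_i(w) for a treatment [w] of unit [i] alone: under no interference the
   treatments of the other units are irrelevant; here they are set to [w]. *)
Definition potential Y (i : 'I_N) (w : bool) : {RV P >-> R} :=
  Y i (const_mx w%:R).

Definition tau Y (A : 'I_N -> {RV P >-> int}) (i : 'I_N) (a : int) : \bar R :=
  'E_(cond_prob P (A i) a)[fun t => potential Y i true t - potential Y i false t].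

End outcomes.

(* Main.v *)
Require Import Defs.
From mathcomp Require Import all_boot all_order all_algebra.
From mathcomp Require Import all_classical all_reals all_analysis.
From mathcomp Require Import measurable_realfun.

Set Implicit Arguments.
Unset Strict Implicit.
Unset Printing Implicit Defensive.

Import Order.TTheory GRing.Theory Num.Theory.
Import numFieldNormedType.Exports.

Local Open Scope classical_set_scope.
Local Open Scope ring_scope.

(* Write V = (A, X), e(V) = P(W = w | V) and m(V) = E[Y(w) | V].  Conditional
   independence gives E[Y(w) 1_{W=w} 1_B(V)] = E[Y(w) e(V) 1_B(V)], and pulling
   out e(V), then m(V), turns the right-hand side into E[m(V) 1_{W=w} 1_B(V)].
   By consistency the left-hand side is E[g(w, V) 1_{W=w} 1_B(V)] with
   g = E[Yobs | W, A, X], so g(w, V) = m(V) almost surely on {W = w}.  Overlap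
   removes the event {W = w}: P(V in E, W = w) is the integral of e(V) over
   {V in E}, and e > 0 on {A = a}.  Hence g(w, a, .) = m(a, .) almost
   everywhere for the law of X given A = a, and averaging m(a, X) over that law
   gives E[Y(w) | A = a]. *)

Section test_functions.
Context d d' (T : measurableType d) (S : measurableType d') (R : realType).
Variables (mu : {measure set T -> \bar R}) (U : T -> S).
Hypothesis mU : measurable_fun [set: T] U.
Local Open Scope ereal_scope.

Let mUi B : measurable B -> measurable (U @^-1` B).
Proof. by move=> mB; rewrite -[X in measurable X]setTI; exact: mU. Qed.

Import HBNNSimple.

Let integral_nnsfun_comp_mul (g : {nnsfun S >-> R}) (F : T -> \bar R) :
  measurable_fun [set: T] F -> (forall t, 0 <= F t) ->
  \int[mu]_t ((g (U t))%:E * F t) =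
  \sum_(y \in range g) (y%:E * \int[mu]_(t in U @^-1` (g @^-1` [set y])) F t).
Proof.
move=> mF F0.
transitivity (\int[mu]_t (\sum_(y \in range g)
    (y * \1_(g @^-1` [set y]) (U t))%:E * F t)).
  apply: eq_integral => t _.
  rewrite -ge0_mule_fsuml; last by move=> y; exact: nnfun_muleindic_ge0.
  by rewrite fsumEFin // -(fimfunE _ (U t)).
have mi y : measurable_fun [set: T] (fun t => (\1_(g @^-1` [set y]) (U t) : R)%:E).
  apply/measurable_EFinP; apply: measurableT_comp => //.
rewrite ge0_integral_fsum//; last 2 first.
- move=> y; apply: emeasurable_funM => //; under eq_fun do rewrite EFinM.
  exact: measurable_funeM.
- by move=> y t _; rewrite mule_ge0// nnfun_muleindic_ge0.
apply: eq_fsbigr => y; rewrite inE => -[s _ gsy].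
under eq_integral do rewrite EFinM -muleA.
rewrite ge0_integralZl//; last 3 first.
- by apply: emeasurable_funM.
- by move=> t _; rewrite mule_ge0// lee_fin.
- by rewrite lee_fin -gsy.
congr (_ * _); rewrite [RHS]integral_mkcond; apply: eq_integral => t _.
rewrite /patch indicE; set B := g @^-1` _.
have -> : (t \in U @^-1` B) = (U t \in B) by apply/idP/idP; rewrite !inE.
by case: ifPn => _; rewrite ?mul1e ?mul0e.
Qed.

Lemma ge0_integral_comp_mul (F1 F2 : T -> \bar R) (h : S -> \bar R) :
  measurable_fun [set: T] F1 -> measurable_fun [set: T] F2 ->
  (forall t, 0 <= F1 t) -> (forall t, 0 <= F2 t) ->
  (forall t, F1 t \is a fin_num) -> (forall t, F2 t \is a fin_num) ->
  (forall B, measurable B ->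
    \int[mu]_(t in U @^-1` B) F1 t = \int[mu]_(t in U @^-1` B) F2 t) ->
  measurable_fun [set: S] h -> (forall s, 0 <= h s) ->
  \int[mu]_t (h (U t) * F1 t) = \int[mu]_t (h (U t) * F2 t).
Proof.
move=> mF1 mF2 F10 F20 F1fin F2fin F12 mh h0.
pose g := nnsfun_approx measurableT mh.
have approx F : measurable_fun [set: T] F -> (forall t, 0 <= F t) ->
    (forall t, F t \is a fin_num) ->
    \int[mu]_t (h (U t) * F t) =
    lim (\int[mu]_t ((g n (U t))%:E * F t) @[n --> \oo]).
  move=> mF F0 Ffin.
  have hF t : h (U t) * F t = lim ((g n (U t))%:E * F t @[n --> \oo]).
    apply/esym/cvg_lim => //; apply: cvgeZr => //.
    exact: cvg_nnsfun_approx.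
  under eq_integral => t _ do rewrite hF.
  apply: monotone_convergence => //.
  - move=> n; apply: emeasurable_funM => //; apply/measurable_EFinP.
    exact: measurableT_comp.
  - by move=> n t _; rewrite mule_ge0// lee_fin.
  - move=> t _ a b ab; rewrite lee_wpmul2r// lee_fin.
    by have /lefP := nd_nnsfun_approx measurableT mh ab; exact.
rewrite !approx//; congr (limn _); apply/funext => n.
rewrite !integral_nnsfun_comp_mul//.
by apply: eq_fsbigr => y _; rewrite F12.
Qed.

Lemma integral_comp_mul (Z1 Z2 : T -> R) (h : S -> R) :
  mu.-integrable [set: T] (EFin \o Z1) -> mu.-integrable [set: T] (EFin \o Z2) ->
  (forall B, measurable B ->
    \int[mu]_(t in U @^-1` B) (Z1 t)%:E = \int[mu]_(t in U @^-1` B) (Z2 t)%:E) ->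
  measurable_fun [set: S] h ->
  mu.-integrable [set: T] (fun t => (h (U t) * Z1 t)%:E) ->
  mu.-integrable [set: T] (fun t => (h (U t) * Z2 t)%:E) ->
  \int[mu]_t (h (U t) * Z1 t)%:E = \int[mu]_t (h (U t) * Z2 t)%:E.
Proof.
(* Adding G = |Z1| + |Z2| to both sides makes the integrands nonnegative. *)
move=> iZ1 iZ2 Z12.
pose G t := (`|Z1 t| + `|Z2 t|)%R.
have iG : mu.-integrable [set: T] (EFin \o G).
  rewrite (_ : _ \o _ = (abse \o (EFin \o Z1)) \+ (abse \o (EFin \o Z2)))//.
  by apply: integrableD => //; exact: integrable_abse.
have ge0_case (k : S -> R) : measurable_fun [set: S] k ->
    (forall s, 0 <= k s)%R ->
    mu.-integrable [set: T] (fun t => (k (U t) * Z1 t)%:E) ->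
    mu.-integrable [set: T] (fun t => (k (U t) * Z2 t)%:E) ->
    \int[mu]_t (k (U t) * Z1 t)%:E = \int[mu]_t (k (U t) * Z2 t)%:E.
  move=> mk k0 ik1 ik2.
  have ikG : mu.-integrable [set: T] (fun t => (k (U t) * G t)%:E).
    apply: eq_integrable (integrableD _ (integrable_abse ik1)
      (integrable_abse ik2)) => // t _ /=.
    by rewrite -EFinD !normrM (ger0_norm (k0 _)) mulrDr.
  have := @ge0_integral_comp_mul (fun t => (Z1 t + G t)%:E)
    (fun t => (Z2 t + G t)%:E) (EFin \o k).
  have split_int Z B : measurable B -> mu.-integrable [set: T] (EFin \o Z) ->
      \int[mu]_(t in U @^-1` B) (Z t + G t)%:E =
      \int[mu]_(t in U @^-1` B) (Z t)%:E + \int[mu]_(t in U @^-1` B) (G t)%:E.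
    move=> mB iZ; under eq_integral do rewrite EFinD.
    by rewrite integralD//; [exact: mUi|
      apply: integrableS (@subsetT _ _) iZ|
      apply: integrableS (@subsetT _ _) iG] => //; exact: mUi.
  have mZ Z : mu.-integrable [set: T] (EFin \o Z) ->
      measurable_fun [set: T] (fun t => (Z t + G t)%:E).
    move=> iZ; under eq_fun do rewrite EFinD.
    by apply: emeasurable_funD; [exact: measurable_int iZ|
      exact: measurable_int iG].
  have Z1G t : (0 <= Z1 t + G t)%R.
    by rewrite /G addrA addr_ge0// -lerBlDl sub0r -normrN ler_norm.
  have Z2G t : (0 <= Z2 t + G t)%R.
    by rewrite /G addrCA addr_ge0// -lerBlDl sub0r -normrN ler_norm.
  move=> /(_ (mZ _ iZ1) (mZ _ iZ2) Z1G Z2G (fun=> isT) (fun=> isT)).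
  have expand Z : mu.-integrable [set: T] (fun t => (k (U t) * Z t)%:E) ->
      \int[mu]_t ((EFin \o k) (U t) * (Z t + G t)%:E) =
      \int[mu]_t (k (U t) * Z t)%:E + \int[mu]_t (k (U t) * G t)%:E.
    move=> ikZ; under eq_integral do rewrite /= -EFinM mulrDr EFinD.
    by rewrite integralD.
  rewrite (expand _ ik1) (expand _ ik2) => H.
  have kGfin := integrable_fin_num measurableT ikG.
  rewrite -[LHS](addeK _ kGfin) -[RHS](addeK _ kGfin); congr (_ - _).
  apply: H => [B mB||s]; [|exact/measurable_EFinP|by rewrite /= lee_fin].
  by rewrite (split_int _ _ mB iZ1) (split_int _ _ mB iZ2) Z12.
move=> mh ih1 ih2.
have inh Z : mu.-integrable [set: T] (EFin \o Z) ->
    mu.-integrable [set: T] (fun t => (h (U t) * Z t)%:E) ->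
    mu.-integrable [set: T] (fun t => (`|h (U t)| * Z t)%:E).
  move=> iZ; apply: le_integrable => //.
    apply/measurable_EFinP; apply: measurable_funM; last first.
      exact/measurable_EFinP/(measurable_int mu).
    by apply: measurableT_comp => //; exact: measurableT_comp.
  by move=> t _ /=; rewrite lee_fin !normrM normr_id.
have inD Z : mu.-integrable [set: T] (EFin \o Z) ->
    mu.-integrable [set: T] (fun t => (h (U t) * Z t)%:E) ->
    mu.-integrable [set: T] (fun t => ((h (U t) + `|h (U t)|) * Z t)%:E).
  move=> iZ ihZ; apply: eq_integrable (integrableD _ ihZ (inh _ iZ ihZ)) => //.
  by move=> t _ /=; rewrite -EFinD mulrDl.
have split_int Z : mu.-integrable [set: T] (EFin \o Z) ->
    mu.-integrable [set: T] (fun t => (h (U t) * Z t)%:E) ->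
    \int[mu]_t (h (U t) * Z t)%:E =
    \int[mu]_t ((h (U t) + `|h (U t)|) * Z t)%:E -
    \int[mu]_t (`|h (U t)| * Z t)%:E.
  move=> iZ ihZ; rewrite -integralB//; [|exact: inD|exact: inh].
  by apply: eq_integral => t _; rewrite -EFinB -mulrBl addrK.
rewrite !split_int//; congr (_ - _).
- apply: (ge0_case (fun s => h s + `|h s|)%R) => //;
    [|by move=> s; rewrite -lerBlDl sub0r -normrN ler_norm|exact: inD..].
  by apply: measurable_funD => //; exact: measurableT_comp.
- by apply: (ge0_case (fun s => `|h s|)%R) => //;
    [exact: measurableT_comp|exact: inh..].
Qed.

End test_functions.

Lemma indic_preimage (T T' : Type) (R : pzRingType) (f : T -> T') (B : set T')
  (t : T) : \1_(f @^-1` B) t = \1_B (f t) :> R.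
Proof. by rewrite !indicE. Qed.

Lemma normr_indicM_le (T : Type) (R : numDomainType) (B : set T) (t : T) (x : R) :
  `|\1_B t * x| <= `|x|.
Proof. by rewrite indicE; case: (t \in B); rewrite ?mul1r// mul0r normr0. Qed.

Lemma measurable_set_ltr d (T : measurableType d) (R : realType) (f g : T -> R) :
  measurable_fun [set: T] f -> measurable_fun [set: T] g ->
  measurable [set t | f t < g t].
Proof.
move=> mf mg; rewrite -[X in measurable X]setTI.
exact: (measurable_fun_ltr mf mg measurableT (Y := [set true])).
Qed.

Lemma measurable_set_neqr d (T : measurableType d) (R : realType) (f g : T -> R) :
  measurable_fun [set: T] f -> measurable_fun [set: T] g ->
  measurable [set t | f t != g t].
Proof.
move=> mf mg; rewrite set_neq_lt.
by apply: measurableU; exact: measurable_set_ltr.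
Qed.

Section real_integrals.
Context d (T : measurableType d) (R : realType) (mu : {measure set T -> \bar R}).
Local Open Scope ereal_scope.

Lemma integral_indicM (D : set T) (f : T -> R) :
  \int[mu]_(t in D) (f t)%:E = \int[mu]_t (\1_D t * f t)%:E.
Proof.
rewrite integral_mkcond epatch_indic; apply: eq_integral => t _ /=.
by rewrite -EFinM mulrC.
Qed.

Lemma integrableM_le1 (h f : T -> R) : measurable_fun [set: T] h ->
  (forall t, `|h t| <= 1)%R -> mu.-integrable [set: T] (EFin \o f) ->
  mu.-integrable [set: T] (fun t => (h t * f t)%:E).
Proof.
move=> mh h1 iF; apply: (le_integrable _ _ _ iF) => //.
  apply/measurable_EFinP; apply: measurable_funM => //.
  exact/measurable_EFinP/(measurable_int mu iF).
by move=> t _ /=; rewrite lee_fin normrM ler_piMl.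
Qed.

Lemma lt_integral_null (D : set T) (f g : T -> R) : measurable D ->
  mu.-integrable D (EFin \o f) -> mu.-integrable D (EFin \o g) ->
  (forall t, D t -> f t < g t)%R ->
  \int[mu]_(t in D) (g t)%:E <= \int[mu]_(t in D) (f t)%:E -> mu D = 0.
Proof.
move=> mD iF ig fg gf.
have igf : mu.-integrable D (fun t => (g t)%:E - (f t)%:E) by exact: integrableB.
have : \int[mu]_(t in D) `|(g t)%:E - (f t)%:E| = 0.
  transitivity (\int[mu]_(t in D) ((g t)%:E - (f t)%:E)).
    apply: eq_integral => t /[!inE] Dt.
    by rewrite gee0_abs// -EFinB lee_fin subr_ge0 ltW// fg.
  apply/eqP; rewrite eq_le; apply/andP; split; last first.
    by apply: integral_ge0 => t Dt; rewrite -EFinB lee_fin subr_ge0 ltW// fg.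
  by rewrite integralB// sube_le0.
move=> /(ae_eq_integral_abs mu mD (measurable_int mu igf)) [N [mN N0 DN]].
apply: (subset_measure0 mD mN _ N0) => t Dt; apply: DN => /= /(_ Dt).
by rewrite -EFinB => -[/eqP]; rewrite subr_eq0 gt_eqF// fg.
Qed.

End real_integrals.

Section conditional_expectation.
Context d d' (T : measurableType d) (T' : measurableType d') (R : realType).
Variables (P : probability T R) (V : T -> T').
Hypothesis mV : measurable_fun [set: T] V.
Local Open Scope ereal_scope.

Let mVi B : measurable B -> measurable (V @^-1` B).
Proof. by move=> mB; rewrite -[X in measurable X]setTI; exact: mV. Qed.

Lemma is_condE_pullout (Z : T -> R) (m h : T' -> R) : is_condE P V Z m ->
  P.-integrable [set: T] (EFin \o Z) -> measurable_fun [set: T'] h ->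
  P.-integrable [set: T] (fun t => (h (V t) * m (V t))%:E) ->
  P.-integrable [set: T] (fun t => (h (V t) * Z t)%:E) ->
  \int[P]_t (h (V t) * m (V t))%:E = \int[P]_t (h (V t) * Z t)%:E.
Proof. by move=> [mm im mE] iZ mh; exact: integral_comp_mul. Qed.

Lemma is_condE_pullout_le1 (Z : T -> R) (m h : T' -> R) : is_condE P V Z m ->
  P.-integrable [set: T] (EFin \o Z) -> measurable_fun [set: T'] h ->
  (forall v, `|h v| <= 1)%R ->
  \int[P]_t (h (V t) * m (V t))%:E = \int[P]_t (h (V t) * Z t)%:E.
Proof.
move=> mE iZ mh h1; have mhV : measurable_fun [set: T] (h \o V).
  exact: measurableT_comp.
apply: is_condE_pullout => //; last exact: integrableM_le1.
case: mE => _ im _; apply: (@integrableM_le1 _ _ _ P (h \o V) (m \o V)) => // t.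
exact: h1.
Qed.

Lemma is_condE_indic_bounds (A : set T) (e : T' -> R) : measurable A ->
  is_condE P V \1_A e -> {ae P, forall t, (0 <= e (V t) <= 1)%R}.
Proof.
move=> mA [me ie eE].
have mlt : measurable [set v | (e v < 0)%R] by exact: measurable_set_ltr.
have mgt : measurable [set v | (1 < e v)%R] by exact: measurable_set_ltr.
have P0 : P (V @^-1` [set v | (e v < 0)%R]) = 0.
  apply: (@lt_integral_null _ _ _ P _ (e \o V) (cst 0%R)) => //.
  - exact: mVi.
  - by apply: integrableS ie => //; exact: mVi.
  - by apply: finite_measure_integrable_cst; exact: mVi.
  - rewrite (eE _ mlt) integral0_eq//.
    by apply: integral_ge0 => t _; rewrite lee_fin.
have P1 : P (V @^-1` [set v | (1 < e v)%R]) = 0.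
  apply: (@lt_integral_null _ _ _ P _ (cst 1%R) (e \o V)) => //.
  - exact: mVi.
  - by apply: finite_measure_integrable_cst; exact: mVi.
  - by apply: integrableS ie => //; exact: mVi.
  - rewrite (eE _ mgt); apply: ge0_le_integral => //; [exact: mVi| | |].
    + exact/measurable_EFinP/measurable_indic.
    + exact/measurable_EFinP.
    + by move=> t _; rewrite lee_fin indicE; case: (_ \in _).
exists (V @^-1` [set v | (e v < 0)%R] `|` V @^-1` [set v | (1 < e v)%R]).
split; first by apply: measurableU; exact: mVi.
  by apply: null_set_setU => //; exact: mVi.
move=> t /= /negP; rewrite negb_and -!ltNge => /orP[]; by [left|right].
Qed.

Lemma is_condE_ae_eq (Z : T -> R) (m m' : T' -> R) :
  measurable_fun [set: T'] m' -> {ae P, forall t, m (V t) = m' (V t)} ->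
  is_condE P V Z m -> is_condE P V Z m'.
Proof.
move=> mm' mm'E [mm im mE]; split=> //.
  have [_ imlt] := integrableP _ _ _ im.
  apply/integrableP; split; first exact/measurable_EFinP/measurableT_comp.
  rewrite (@ae_eq_integral _ _ _ P _ (fun t => `|(m (V t))%:E|))//.
  - apply/measurableT_comp => //.
    exact/measurable_EFinP/measurableT_comp.
  - apply/measurableT_comp => //.
    exact/measurable_EFinP/measurableT_comp.
  - by apply: filterS mm'E => t /= -> _.
move=> B mB; rewrite -mE//; apply: ae_eq_integral => //.
- exact: mVi.
- by apply/measurable_EFinP/measurable_funTS/measurableT_comp.
- by apply/measurable_EFinP/measurable_funTS/measurableT_comp.
- by apply: filterS mm'E => t /= -> _.
Qed.

End conditional_expectation.

Section conditional_independence.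
Context d d1 d2 d3 (T : measurableType d) (T1 : measurableType d1)
  (T2 : measurableType d2) (T3 : measurableType d3) (R : realType).
Variables (P : probability T R) (U1 : T -> T1) (U2 : T -> T2) (V : T -> T3).
Hypotheses (mU1 : measurable_fun [set: T] U1)
  (mU2 : measurable_fun [set: T] U2) (mV : measurable_fun [set: T] V).
Hypothesis indep : cond_indep P U1 U2 V.
Local Open Scope ereal_scope.

Let preimageT d' (T' : measurableType d') (f : T -> T') (B : set T') :
  measurable_fun [set: T] f -> measurable B -> measurable (f @^-1` B).
Proof. by move=> mf mB; rewrite -[X in measurable X]setTI; exact: mf. Qed.

(* [condE P V \1_A] lies in [0, 1] only almost everywhere; clamping it yields a
   version bounded everywhere. *)
Lemma is_condE_indic01 (A : set T) : measurable A ->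
  exists e : T3 -> R, [/\ is_condE P V \1_A e, forall v, (0 <= e v <= 1)%R &
    {ae P, forall t, condE P V \1_A (V t) = e (V t)}].
Proof.
move=> mA; have e0P := condEP mV (integrable_indic P mA).
pose e v := Num.max 0%R (Num.min (condE P V \1_A v) 1%R).
have me : measurable_fun [set: T3] e.
  by apply: measurable_maxr => //; apply: measurable_minr => //; case: e0P.
have e0e : {ae P, forall t, condE P V \1_A (V t) = e (V t)}.
  apply: filterS (is_condE_indic_bounds mV mA e0P) => t /andP[c0 c1].
  by rewrite /e min_l// max_r.
exists e; split=> //; first exact: (is_condE_ae_eq mV me e0e).
by move=> v; rewrite /e le_max lexx/= ge_max ler01 ge_min lexx orbT.
Qed.

Lemma cond_indep_integral (k : T1 -> R) (m : T3 -> R) (B2 : set T2)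
    (B : set T3) :
  measurable_fun [set: T1] k -> P.-integrable [set: T] (EFin \o (k \o U1)) ->
  is_condE P V (k \o U1) m -> measurable B2 -> measurable B ->
  \int[P]_(t in V @^-1` B `&` U2 @^-1` B2) (k (U1 t))%:E =
  \int[P]_(t in V @^-1` B `&` U2 @^-1` B2) (m (V t))%:E.
Proof.
move=> mk ik mP mB2 mB; set A := U2 @^-1` B2.
have mA : measurable A by exact: preimageT.
have mVB : measurable (V @^-1` B) by exact: preimageT.
have [e [eP e01 e0e]] := is_condE_indic01 mA.
have [me ie _] := eP; have [mm im _] := mP.
have mBind : measurable_fun [set: T3] (\1_B : T3 -> R) by exact: measurable_indic.
have mAind : measurable_fun [set: T] (\1_A : T -> R) by exact: measurable_indic.
pose h v : R := (\1_B v * e v)%R.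
have mh : measurable_fun [set: T3] h by exact: measurable_funM.
have ind01 (X : Type) (C : set X) x : (`|\1_C x : R| <= 1)%R.
  by rewrite indicE; case: (_ \in _); rewrite ?normr1 ?normr0.
have h1 v : (`|h v| <= 1)%R.
  rewrite (le_trans (normr_indicM_le _ _ _))//.
  by case/andP: (e01 v) => e0 e1; rewrite ger0_norm.
have iAB : P.-integrable [set: T] (EFin \o (fun t => \1_A t * \1_B (V t) : R)%R).
  apply: (@integrableM_le1 _ _ _ P \1_A (\1_B \o V)) => //.
  exact: (integrable_indic P mVB).
have ihV : P.-integrable [set: T] (EFin \o (h \o V)).
  apply: (@integrableM_le1 _ _ _ P (\1_B \o V) (e \o V)) => //.
    exact: measurableT_comp.
  by move=> t; exact: ind01.
have weights S : measurable S ->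
    \int[P]_(t in U1 @^-1` S) (\1_A t * \1_B (V t))%:E =
    \int[P]_(t in U1 @^-1` S) (h (V t))%:E.
  move=> mS; have mU1S : measurable (U1 @^-1` S) by exact: preimageT.
  have iS := integrable_indic P mU1S.
  have iSA := integrable_indic P (measurableI _ _ mU1S mA).
  have cP := condEP mV iS; have fP := condEP mV iSA.
  transitivity (\int[P]_(t in V @^-1` B) (\1_(U1 @^-1` S `&` A) t)%:E).
    rewrite integral_indicM [RHS]integral_indicM; apply: eq_integral => t _.
    by rewrite indicI/= (indic_preimage _ V) mulrA mulrC.
  case: fP => mf _ <-//.
  transitivity (\int[P]_(t in V @^-1` B)
      (condE P V \1_(U1 @^-1` S) (V t) * e (V t))%:E).
    apply: ae_eq_integral => //.
    - by apply/measurable_EFinP/measurable_funTS/measurableT_comp.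
    - apply/measurable_EFinP/measurable_funTS/measurable_funM.
        by apply: measurableT_comp => //; case: cP.
      exact: measurableT_comp.
    - apply: filterS2 e0e (indep mS mB2) => t e0e -> _.
      by rewrite e0e.
  rewrite integral_indicM [RHS]integral_indicM.
  transitivity (\int[P]_t (h (V t) * condE P V \1_(U1 @^-1` S) (V t))%:E).
    apply: eq_integral => t _; congr (_%:E).
    by rewrite /h indic_preimage mulrA mulrAC.
  rewrite (is_condE_pullout_le1 mV cP)//.
  by apply: eq_integral => t _; rewrite mulrC.
transitivity (\int[P]_t (k (U1 t) * (\1_A t * \1_B (V t)))%:E).
  rewrite integral_indicM; apply: eq_integral => t _; congr (_%:E).
  by rewrite indicI/= (indic_preimage _ V) [LHS]mulrC;
    congr (_ * _)%R; rewrite mulrC.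
rewrite (integral_comp_mul mU1 iAB ihV weights mk); last 2 first.
- under eq_fun do rewrite mulrC.
  apply: (integrableM_le1 _ _ ik).
    by apply: measurable_funM => //; exact: measurableT_comp.
  by move=> t; rewrite (le_trans (normr_indicM_le _ _ _)).
- under eq_fun do rewrite mulrC.
  apply: (@integrableM_le1 _ _ _ P (h \o V) (k \o U1)) => //.
    exact: measurableT_comp.
  by move=> t; exact: h1.
transitivity (\int[P]_t (h (V t) * m (V t))%:E).
  rewrite (is_condE_pullout_le1 mV mP)//.
  by apply: eq_integral => t _; rewrite mulrC.
transitivity (\int[P]_t ((\1_B (V t) * m (V t)) * e (V t))%:E).
  by apply: eq_integral => t _; rewrite /h mulrAC.
have mBm : measurable_fun [set: T3] (fun v => \1_B v * m v)%R.
  exact: measurable_funM.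
have iBm : P.-integrable [set: T] (fun t => (\1_B (V t) * m (V t))%:E).
  apply: (@integrableM_le1 _ _ _ P (\1_B \o V) (m \o V)) => //.
    exact: measurableT_comp.
  by move=> t; exact: ind01.
rewrite (is_condE_pullout mV eP _ mBm); last 3 first.
- exact: integrable_indic.
- under eq_fun do rewrite mulrC.
  apply: (@integrableM_le1 _ _ _ P (e \o V)) => //; first exact: measurableT_comp.
  by move=> t; case/andP: (e01 (V t)) => e0 e1; rewrite ger0_norm.
- under eq_fun do rewrite mulrC.
  exact: integrableM_le1.
rewrite [RHS]integral_indicM; apply: eq_integral => t _; congr (_%:E).
by rewrite indicI/= (indic_preimage _ V) mulrAC.
Qed.

End conditional_independence.

Section conditioning_on_age.
Context d (T : measurableType d) (R : realType) (P : probability T R).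
Variables (A : {mfun T >-> int}) (a : int).
Hypothesis a_pos : (0 < P (A @^-1` [set a]))%E.
Local Open Scope ereal_scope.

Let D := A @^-1` [set a].
Let mD : measurable D. Proof. exact: measurable_eq_int. Qed.
Let K_ge0 : (0 <= (fine (P D))^-1)%R.
Proof. by rewrite invr_ge0 fine_ge0. Qed.
Let K : {nonneg R} := NngNum K_ge0.

Lemma cond_probE S : cond_prob P A a S = P (S `&` D) * (fine (P D))^-1%:E.
Proof.
rewrite /cond_prob /= /mnormalize /= /mrestr setTI gt_eqF//=.
by rewrite lt_eqF// (le_lt_trans (probability_le1 P mD)) ?ltry.
Qed.

Let ge0_integral_cond_prob (f : T -> \bar R) : measurable_fun [set: T] f ->
  (forall t, 0 <= f t) ->
  \int[cond_prob P A a]_t f t = K%:num%:E * \int[P]_(t in D) f t.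
Proof.
move=> mf f0; have mDC : measurable (~` D) by exact: measurableC.
rewrite (ge0_negligible_integral mDC)//; last first.
  by rewrite [LHS]cond_probE setICl measure0 mul0e.
rewrite setTD setCK (@eq_measure_integral _ _ _ _ (mscale K P)); last first.
  move=> S mS SD; rewrite [LHS]cond_probE (setIidl SD) muleC.
  by rewrite /mscale.
by rewrite ge0_integral_mscale//; exact: measurable_funTS.
Qed.

Lemma integrable_cond_prob (f : T -> \bar R) : measurable_fun [set: T] f ->
  P.-integrable D f -> (cond_prob P A a).-integrable [set: T] f.
Proof.
move=> mf iF; apply/integrableP; split => //.
rewrite ge0_integral_cond_prob//; last exact: measurableT_comp.
by rewrite lte_mul_pinfty//; case/integrableP: iF.
Qed.

Lemma integral_cond_prob (f : T -> \bar R) : measurable_fun [set: T] f ->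
  P.-integrable D f ->
  \int[cond_prob P A a]_t f t = (fine (P D))^-1%:E * \int[P]_(t in D) f t.
Proof.
move=> mf iF; rewrite [LHS]integralE.
rewrite (ge0_integral_cond_prob (measurable_funepos mf))//.
rewrite (ge0_integral_cond_prob (measurable_funeneg mf))//.
by rewrite -muleBr -?integralE//; exact: integrable_add_def.
Qed.

End conditioning_on_age.

Section identification.
Context d dX d1 (T : measurableType d) (XT : measurableType dX)
  (T1 : measurableType d1) (R : realType) (P : probability T R).
Variables (U : T -> T1) (k : T1 -> R) (W : {mfun T >-> bool})
  (A : {mfun T >-> int}) (X : {mfun T >-> XT}) (Yobs : T -> R).
Variables (w : bool) (a : int).
Hypotheses (mU : measurable_fun [set: T] U) (mk : measurable_fun [set: T1] k).
Hypothesis iY : P.-integrable [set: T] (EFin \o (k \o U)).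
Hypothesis iYobs : P.-integrable [set: T] (EFin \o Yobs).
Hypothesis YobsE : forall t, W t = w -> Yobs t = k (U t).
Hypothesis unconf : cond_indep P U W (fun t => (A t, X t)).
Hypothesis a_pos : (0 < P (A @^-1` [set a]))%E.

Let V t := (A t, X t).
Let g x := condE P (fun t => (W t, A t, X t)) Yobs (w, x.1, x.2).
Let m := condE P V (k \o U).
Let e := condE P V \1_(W @^-1` [set w]).

Local Open Scope ereal_scope.

Let mV : measurable_fun [set: T] V.
Proof. exact: measurable_fun_pair. Qed.

Let mWAX : measurable_fun [set: T] (fun t => (W t, A t, X t)).
Proof. by apply: measurable_fun_pair => //; exact: measurable_fun_pair. Qed.

Let mVi B : measurable B -> measurable (V @^-1` B).
Proof. by move=> mB; rewrite -[X in measurable X]setTI; exact: mV. Qed.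

Let mW : measurable (W @^-1` [set w]).
Proof. exact: measurable_funPTI. Qed.

Let gP := condEP mWAX iYobs.
Let mP := condEP mV iY.
Let eP := condEP mV (integrable_indic P mW).

Let mg : measurable_fun setT g.
Proof.
case: gP => mg _ _; apply: (measurableT_comp mg).
apply: measurable_fun_pair; last exact: measurable_snd.
by apply: measurable_fun_pair => //; exact: measurable_fst.
Qed.

Let integral_treated B : measurable B ->
  \int[P]_(t in V @^-1` B `&` W @^-1` [set w]) (g (V t))%:E =
  \int[P]_(t in V @^-1` B `&` W @^-1` [set w]) (m (V t))%:E.
Proof.
move=> mB; rewrite -(cond_indep_integral mU _ mV unconf mk iY mP)//.
have -> : V @^-1` B `&` W @^-1` [set w] = (fun t => (W t, A t, X t)) @^-1`
    [set y | y.1.1 = w /\ B (y.1.2, y.2)].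
  by apply/seteqP; split=> t [].
set C := [set y | _].
have mC : measurable C.
  rewrite (_ : C = (fun y => y.1.1) @^-1` [set w] `&`
                   (fun y => (y.1.2, y.2)) @^-1` B)//.
  apply: measurableI.
    rewrite -[X in measurable X]setTI.
    by apply: (measurableT_comp measurable_fst measurable_fst).
  rewrite -[X in measurable X]setTI.
  suff : measurable_fun setT (fun y : bool * int * XT => (y.1.2, y.2)) by exact.
  apply: measurable_fun_pair; last exact: measurable_snd.
  exact: (measurableT_comp measurable_snd measurable_fst).
case: gP => _ _ /(_ _ mC) gE.
transitivity (\int[P]_(t in (fun t => (W t, A t, X t)) @^-1` C)
    (condE P (fun t => (W t, A t, X t)) Yobs (W t, A t, X t))%:E).
  by apply: eq_integral => t; rewrite inE => -[/= Wt _]; rewrite /g Wt.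
rewrite gE; apply: eq_integral => t; rewrite inE => -[/= Wt _].
by rewrite YobsE.
Qed.

(* Comparing g and m on {W = w} avoids the product g e, whose integrability
   would need a proof. *)
Let treated_null : P (V @^-1` [set v | g v != m v] `&` W @^-1` [set w]) = 0.
Proof.
have [mm im _] := mP; have [_ ig _] := gP.
have mVW B : measurable B -> measurable (V @^-1` B `&` W @^-1` [set w]).
  by move=> mB; apply: measurableI => //; exact: mVi.
have imVW B : measurable B ->
    P.-integrable (V @^-1` B `&` W @^-1` [set w]) (EFin \o (m \o V)).
  by move=> mB; apply: integrableS im => //; exact: mVW.
have igVW B : measurable B ->
    P.-integrable (V @^-1` B `&` W @^-1` [set w]) (EFin \o (g \o V)).
  move=> mB; apply: eq_integrable (integrableS measurableT _ _ ig) => //.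
  - exact: mVW.
  - by move=> t; rewrite inE => -[_ /= Wt]; rewrite /g Wt.
  - exact: mVW.
have mlt : measurable [set v | (g v < m v)%R] by exact: measurable_set_ltr.
have mgt : measurable [set v | (m v < g v)%R] by exact: measurable_set_ltr.
rewrite (_ : _ `&` _ =
    (V @^-1` [set v | (g v < m v)%R] `&` W @^-1` [set w]) `|`
    (V @^-1` [set v | (m v < g v)%R] `&` W @^-1` [set w])); last first.
  by rewrite -setIUl -preimage_setU -set_neq_lt.
apply: null_set_setU; [exact: mVW|exact: mVW| |].
- apply: (@lt_integral_null _ _ _ P _ (g \o V) (m \o V)) => //;
    [exact: mVW|exact: igVW|exact: imVW|by move=> t []|].
  by rewrite -integral_treated.
- apply: (@lt_integral_null _ _ _ P _ (m \o V) (g \o V)) => //;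
    [exact: mVW|exact: imVW|exact: igVW|by move=> t []|].
  by rewrite -integral_treated.
Qed.

Let mE : measurable [set v | g v != m v /\ (0 < e v)%R].
Proof.
have [me _ _] := eP; have [mm _ _] := mP.
by apply: measurableI; [exact: measurable_set_neqr|exact: measurable_set_ltr].
Qed.

Let overlap_null : P (V @^-1` [set v | g v != m v /\ (0 < e v)%R]) = 0.
Proof.
have [me ie eE] := eP; have [mm _ _] := mP.
apply: (@lt_integral_null _ _ _ P _ (cst 0%R) (e \o V)) => //.
- exact: mVi.
- by apply: finite_measure_integrable_cst; exact: mVi.
- by apply: integrableS ie => //; exact: mVi.
- by move=> t [].
rewrite (eE _ mE) integral_indic//; last exact: mVi.
rewrite [leRHS]integral0_eq// measure_le0; apply/eqP.
apply: (subset_measure0 _ _ _ treated_null).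
- by apply: measurableI => //; exact: mVi.
- apply: measurableI => //; apply: mVi.
  exact: measurable_set_neqr.
- by move=> t [Wt [gm _]].
Qed.

Lemma expectation_potential_identified :
  {ae distribution (cond_prob P A a) X, forall x, (0 < e (a, x))%R} ->
  \int[cond_prob P A a]_t (k (U t))%:E =
  \int[distribution (cond_prob P A a) X]_x
    (condE P (fun t => (W t, A t, X t)) Yobs (w, a, x))%:E.
Proof.
move=> overlap; have [mm im mmE] := mP; have [me ie _] := eP.
have mpair : measurable_fun [set: XT] (fun x => (a, x)).
  exact: measurable_fun_pair.
have mga : measurable_fun [set: XT] (fun x => g (a, x)) by exact: measurableT_comp.
have mma : measurable_fun [set: XT] (fun x => m (a, x)) by exact: measurableT_comp.
have mea : measurable_fun [set: XT] (fun x => e (a, x)) by exact: measurableT_comp.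
have mD := measurable_eq_int A a.
have imD : P.-integrable (A @^-1` [set a]) (EFin \o (m \o V)).
  by apply: integrableS im.
have imaD : P.-integrable (A @^-1` [set a]) (fun t => (m (a, X t))%:E).
  by apply: eq_integrable imD => // t; rewrite inE /V => /= ->.
have mmaX : measurable_fun [set: T] (fun t => (m (a, X t))%:E).
  by apply/measurable_EFinP; exact: (measurableT_comp mma).
have mgm : measurable [set x | g (a, x) != m (a, x) /\ (0 < e (a, x))%R].
  by apply: measurableI; [exact: measurable_set_neqr|exact: measurable_set_ltr].
have gm : {ae distribution (cond_prob P A a) X, forall x, m (a, x) = g (a, x)}.
  have : {ae distribution (cond_prob P A a) X,
      forall x, ~ (g (a, x) != m (a, x) /\ (0 < e (a, x))%R)}.
    exists [set x | g (a, x) != m (a, x) /\ (0 < e (a, x))%R]; split=> //.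
      rewrite /distribution /pushforward [LHS]cond_probE//.
      rewrite (_ : P _ = 0) ?mul0e//.
      apply: (subset_measure0 _ _ _ overlap_null).
      - by apply: measurableI => //; exact: measurable_funPTI.
      - exact: mVi.
      - by move=> t [/= + At]; rewrite /V At.
    by move=> x /= /contrapT.
  apply: filterS2 overlap => x e0 /not_andP[/negP/negPn/eqP//|].
  by rewrite e0.
rewrite integral_cond_prob//; last 2 first.
- exact/measurable_EFinP/measurableT_comp.
- by apply: integrableS iY.
have -> : \int[P]_(t in A @^-1` [set a]) (k (U t))%:E =
    \int[P]_(t in A @^-1` [set a]) (m (a, X t))%:E.
  have /mmE : measurable ([set a] `*` [set: XT]) by exact: measurableX.
  rewrite (_ : V @^-1` _ = A @^-1` [set a]); last first.
    by apply/seteqP; split=> t //= [].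
  move=> <-; apply: eq_integral => t; rewrite inE => /= At.
  by rewrite -[condE _ _ _ _]/(m (V t)) /V At.
rewrite -integral_cond_prob//.
rewrite -(@integral_distribution _ _ _ _ _ _ X (fun x => (m (a, x))%:E));
  last 2 first.
- exact/measurable_EFinP.
- exact: integrable_cond_prob.
apply: ae_eq_integral => //; [exact/measurable_EFinP|exact/measurable_EFinP|].
by apply: filterS gm => x /= -> _.
Qed.

End identification.

(* World: MathComp-Analysis.  Age is one of the measured covariates, so
   unconfoundedness is conditional on (A_i, X_i); E_X averages over the law of
   X_i given A_i = a. *)
Theorem theorem1 (R : realType) (d dX : measure_display)
    (Omega : measurableType d) (XT : measurableType dX)
    (P : probability Omega R) (N : nat)
    (Y : 'I_N -> 'rV[R]_N -> {RV P >-> R})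
    (Yobs : 'I_N -> {RV P >-> R})
    (A : 'I_N -> {RV P >-> int})
    (W : 'I_N -> {RV P >-> bool})
    (X : 'I_N -> {RV P >-> XT})
    (Q : probability (R * R * int * bool * XT)%type R)
    (draws : iid_draws P Q
      (fun i t => (potential Y i false t, potential Y i true t,
                   A i t, W i t, X i t)))
    (noint : no_interference Y)
    (consist : consistency Y W Yobs)
    (intY : forall i w, P.-integrable [set: Omega] (EFin \o potential Y i w))
    (unconf : forall i,
      cond_indep P (fun t => (potential Y i false t, potential Y i true t))
                   (W i) (fun t => (A i t, X i t)))
    (i : 'I_N) (a : int)
    (a_pos : (0 < P (A i @^-1` [set a]))%E)
    (overlap : forall w : bool,
      {ae distribution (cond_prob P (A i) a) (X i), forall x,
        0 < condE P (fun t => (A i t, X i t)) \1_(W i @^-1` [set w]) (a, x)}) :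
  tau Y A i a =
  ('E_(distribution (cond_prob P (A i) a) (X i))
     [fun x => condE P (fun t => (W i t, A i t, X i t)) (Yobs i) (true, a, x)] -
   'E_(distribution (cond_prob P (A i) a) (X i))
     [fun x => condE P (fun t => (W i t, A i t, X i t)) (Yobs i) (false, a, x)])%E.
Proof.
have YobsE t : Yobs i t = potential Y i (W i t) t.
  by rewrite consist; apply: noint; rewrite !mxE.
have iYobs : P.-integrable [set: Omega] (EFin \o Yobs i).
  apply: (le_integrable measurableT _ _ (integrableD measurableT
    (integrable_abse (intY i true)) (integrable_abse (intY i false)))) => //.
    exact/measurable_EFinP.
  move=> t _ /=; rewrite lee_fin YobsE [leRHS]ger0_norm ?addr_ge0//.
  by case: (W i t); rewrite ?lerDl ?lerDr.
pose U t := (potential Y i false t, potential Y i true t).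
have mU : measurable_fun [set: Omega] U by exact: measurable_fun_pair.
have identified (w : bool) (k : R * R -> R) : measurable_fun setT k ->
    (forall t, k (U t) = potential Y i w t) ->
    (\int[cond_prob P (A i) a]_t (potential Y i w t)%:E =
     'E_(distribution (cond_prob P (A i) a) (X i))
       [fun x => condE P (fun t => (W i t, A i t, X i t)) (Yobs i) (w, a, x)])%E.
  move=> mk kU; under eq_integral do rewrite -kU.
  rewrite unlock; apply: expectation_potential_identified => //.
  - by rewrite (_ : k \o U = potential Y i w)//; exact/funext.
  - by move=> t Wt; rewrite YobsE Wt kU.
  - exact: unconf.
have iD b : P.-integrable (A i @^-1` [set a]) (EFin \o potential Y i b).
  by apply: integrableS (intY i b) => //; exact: measurable_eq_int.
have icp b : (cond_prob P (A i) a).-integrable setT (EFin \o potential Y i b).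
  by apply: integrable_cond_prob => //; exact/measurable_EFinP.
rewrite -(identified true snd measurable_snd)//.
rewrite -(identified false fst measurable_fst)//.
rewrite /tau unlock -integralB//; exact: icp.
Qed.
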